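(* Suppose that $\gamma$ satisfies $$2\gamma(\theta)-\gamma(\theta)\cos(\theta-\phi)-\gamma'(\theta)\sin(\theta-\phi)\ge\gamma(\phi),\qquad\forall\,\theta,\phi\in[-\pi,\pi].$$ Then the ES-PFEM is unconditionally energy stable: for any $\tau>0$, if $(\mathbf X^{m+1},\mu^{m+1})\in\mathbb X_p^h\times\mathbb K_p^h$, $m\ge0$, satisfy for every $m\ge 0$ $$\Big(\frac{\mathbf X^{m+1}-\mathbf X^m}{\tau},\varphi^h\mathbf n^m\Big)^h_{\Gamma^m}+\big(\partial_s\mu^{m+1},\partial_s\varphi^h\big)^h_{\Gamma^m}=0\quad\forall\varphi^h\in\mathbb K_p^h,$$ $$\big(\mu^{m+1},\mathbf n^m\cdot\boldsymbol\omega^h\big)^h_{\Gamma^m}-\big(G(\theta^m)\partial_s\mathbf X^{m+1},\partial_s\boldsymbol\omega^h\big)^h_{\Gamma^m}=0\quad\forall\boldsymbol\omega^h\in\mathbb X_p^h,$$ starting from a given $\mathbf X^0\in\mathbb X_p^h$, then the energies $W_c^m:=\sum_{j=1}^N|\mathbf h_j^m|\,\gamma(\theta_j^m)$ satisfy $$W_c^{m+1}\le W_c^m\le\dots\le W_c^0=\sum_{j=1}^N|\mathbf h_j^0|\,\gamma(\theta_j^0),\qquad\forall m\ge0.$$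
   Context: The surface energy $\gamma\in C^1([-\pi,\pi])$ is positive with $\gamma(-\pi)=\gamma(\pi)$. $G(\theta)=\begin{pmatrix}\gamma(\theta)&-\gamma'(\theta)\\ \gamma'(\theta)&\gamma(\theta)\end{pmatrix}$. For $\mathbf v=(v_1,v_2)^T$, $\mathbf v^\perp=(v_2,-v_1)^T$. Let $N\ge3$ be an integer, $h=1/N$, $\rho_j=jh$ ($0\le j\le N$), $I_j=[\rho_{j-1},\rho_j]$. $\mathbb K_p^h$ is the space of continuous functions $u^h$ on $[0,1]$ which are affine on each $I_j$ and satisfy $u^h(0)=u^h(1)$; $\mathbb X_p^h=\mathbb K_p^h\times\mathbb K_p^h$. For each $m$, $\mathbf h_j^m=(h^m_{j,x},h^m_{j,y})^T=\mathbf X^m(\rho_j)-\mathbf X^m(\rho_{j-1})$, assumed nonzero for all $j$ and $m$ (so that the following are defined): the normal $\mathbf n^m$ is constant on $I_j$ with value $-(\mathbf h_j^m)^\perp/|\mathbf h_j^m|$, and $\theta^m|_{I_j}=\theta_j^m\in[-\pi,\pi]$ satisfies $\cos\theta_j^m=h^m_{j,x}/|\mathbf h_j^m|$, $\sin\theta_j^m=h^m_{j,y}/|\mathbf h_j^m|$. On $\Gamma^m$, for $f$ affine on each $I_j$ (including $f=\mathbf X^{m+1}$), $\partial_s f|_{I_j}=\big(f(\rho_j)-f(\rho_{j-1})\big)/|\mathbf h_j^m|$. The mass-lumped inner product is $(u,v)^h_{\Gamma^m}=\frac12\sum_{j=1}^N|\mathbf h_j^m|\big[(u\cdot v)(\rho_j^-)+(u\cdot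 v)(\rho_{j-1}^+)\big]$, with one-sided limits at the nodes. *)

(* Defs.v *)
From HB Require Import structures.
From mathcomp Require Import all_boot all_order all_algebra.
From mathcomp Require Import all_classical all_reals all_analysis.

Set Implicit Arguments.
Unset Strict Implicit.
Unset Printing Implicit Defensive.

Import Order.TTheory GRing.Theory Num.Theory.
Import numFieldNormedType.Exports.
Local Open Scope classical_set_scope.
Local Open Scope ring_scope.

(* Derivative of f relative to A (one-sided at the endpoints of an interval):
   it depends only on the restriction of f to A. *)
Definition derive_within {R : realType} (A : set R) (f : R -> R) (x : R) : R :=
  lim ((f y - f x) / (y - x) @[y --> within A x^']).

Definition C1_within {R : realType} (A : set R) (f : R -> R) : Prop :=
  (forall x, A x -> cvg ((f y - f x) / (y - x) @[y --> within A x^'])) /\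
  {within A, continuous (derive_within A f)}.

Definition dangle {R : realType} (gamma : R -> R) : R -> R :=
  derive_within `[- pi, pi] gamma.

Definition vec2 {R : realType} (a b : R) : 'cV[R]_2 := \col_i [:: a; b]`_i.

(* The library norm on matrices is the sup norm, hence the Euclidean one here. *)
Definition dot {R : realType} (u v : 'cV[R]_2) : R := (u^T *m v) 0 0.
Definition enorm {R : realType} (u : 'cV[R]_2) : R := Num.sqrt (dot u u).

Definition xc {R : realType} (v : 'cV[R]_2) : R := v 0 0.
Definition yc {R : realType} (v : 'cV[R]_2) : R := v 1 0.
Definition perp {R : realType} (v : 'cV[R]_2) : 'cV[R]_2 :=
  vec2 (yc v) (- xc v).

Definition Gmx {R : realType} (gamma : R -> R) (theta : R) : 'M[R]_2 :=
  \matrix_(i < 2, j < 2)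
    (nth [::] [:: [:: gamma theta; - dangle gamma theta];
                  [:: dangle gamma theta; gamma theta] ] i)`_j.

(* The mesh: rho_j = j h with h = 1 / N. The intervals are indexed from 0, so
   that j : 'I_N stands for [rho_j, rho_(j+1)]. *)
Definition node (R : realType) (N j : nat) : R := j%:R / N%:R.

(* Only the values on [0, 1] of an element of the space are meaningful. *)
Definition Kph {R : realType} (N : nat) (u : R -> R) : Prop :=
  [/\ {within `[0, 1], continuous u},
      forall j : 'I_N, exists a b : R,
        forall x, node R N j <= x <= node R N j.+1 -> u x = a * x + b
    & u 0 = u 1].

Definition Xph {R : realType} (N : nat) (u : R -> 'cV[R]_2) : Prop :=
  Kph N (xc \o u) /\ Kph N (yc \o u).

(* Function equal to c j on the j-th open interval. Its values at the nodes (0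
   by convention) play no role: only one-sided limits there are ever taken. *)
Definition pwconst {R : realType} {V : nmodType} (N : nat) (c : 'I_N -> V)
    (x : R) : V :=
  \sum_(j < N | node R N j < x < node R N j.+1) c j.

Definition edge {R : realType} (N : nat) (X : R -> 'cV[R]_2) (j : 'I_N) :
    'cV[R]_2 :=
  X (node R N j.+1) - X (node R N j).

Definition normal {R : realType} (N : nat) (X : R -> 'cV[R]_2) :
    R -> 'cV[R]_2 :=
  pwconst (fun j : 'I_N => - ((enorm (edge X j))^-1 *: perp (edge X j))).

(* cos and sin leave the choice between -pi and pi open. *)
Definition is_angle {R : realType} (N : nat) (X : R -> 'cV[R]_2)
    (theta : 'I_N -> R) : Prop :=
  forall j, [/\ - pi <= theta j <= pi,
    cos (theta j) = xc (edge X j) / enorm (edge X j)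
  & sin (theta j) = yc (edge X j) / enorm (edge X j)].

(* Arclength derivative, along the polygon X, of a function f which is affine on
   each interval. *)
Definition ds {R : realType} {V : lmodType R} (N : nat) (X : R -> 'cV[R]_2)
    (f : R -> V) : R -> V :=
  pwconst (fun j : 'I_N =>
    (enorm (edge X j))^-1 *: (f (node R N j.+1) - f (node R N j))).

(* Mass lumping on the polygon X; w is the pointwise product of the arguments
   of the inner product. *)
Definition lumped {R : realType} (N : nat) (X : R -> 'cV[R]_2) (w : R -> R) : R :=
  2^-1 * \sum_(j < N) enorm (edge X j) *
    (lim (w x @[x --> (node R N j.+1)^'-]) + lim (w x @[x --> (node R N j)^'+])).

Definition ip {R : realType} (N : nat) (X : R -> 'cV[R]_2) (u v : R -> R) : R :=
  lumped N X (fun x => u x * v x).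
Definition ipv {R : realType} (N : nat) (X : R -> 'cV[R]_2)
    (u v : R -> 'cV[R]_2) : R :=
  lumped N X (fun x => dot (u x) (v x)).

(* One time step of ES-PFEM, from the curve X (with angles theta) to the curve
   X' and the chemical potential mu'. *)
Definition ES_PFEM_step {R : realType} (gamma : R -> R) (N : nat) (tau : R)
    (X : R -> 'cV[R]_2) (theta : 'I_N -> R) (X' : R -> 'cV[R]_2)
    (mu' : R -> R) : Prop :=
  (forall phi : R -> R, Kph N phi ->
     ipv N X (fun x => tau^-1 *: (X' x - X x)) (fun x => phi x *: normal N X x)
     + ip N X (ds N X mu') (ds N X phi) = 0) /\
  (forall omega : R -> 'cV[R]_2, Xph N omega ->
     ip N X mu' (fun x => dot (normal N X x) (omega x))
     - ipv N X (fun x => Gmx gamma (pwconst theta x) *m ds N X X' x)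
               (ds N X omega) = 0).

Definition energy {R : realType} (gamma : R -> R) (N : nat)
    (X : R -> 'cV[R]_2) (theta : 'I_N -> R) : R :=
  \sum_(j < N) enorm (edge X j) * gamma (theta j).

(* Main.v *)
Require Import Defs.
From HB Require Import structures.
From mathcomp Require Import all_boot all_order all_algebra.
From mathcomp Require Import all_classical all_reals all_analysis.
From mathcomp Require Import ring.

Set Implicit Arguments.
Unset Strict Implicit.
Unset Printing Implicit Defensive.

Import Order.TTheory GRing.Theory Num.Theory.
Import numFieldNormedType.Exports.
Local Open Scope classical_set_scope.
Local Open Scope ring_scope.

(** Write W for the energy of X, W' for that of the next curve X', and h, k for
    the edges of X and X' over the same interval of the mesh. The scheme is a
    gradient flow in weak form, and the argument tests it with its own solution.

    Taking [phi = tau mu'] in the first equation and [omega = X' - X] in the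
    second makes the terms that couple mu' with the normal velocity equal; what
    is left is [(G d_s X', d_s (X' - X)) = - tau |d_s mu'|^2 <= 0]
    ([scheme_dissipation]).

    It remains to bound the left-hand side below by W' - W, which can be done
    edge by edge ([edge_energy_le]). If t and p are the angles of h and k, the
    contribution of an edge is
      [gamma(t) |k|^2 / |h| - |k| (gamma(t) cos (t-p) + gamma'(t) sin (t-p))].
    By [|k|^2 / |h| >= 2 |k| - |h|], that is [(|k| - |h|)^2 >= 0], it is at least
      [|k| (2 gamma(t) - gamma(t) cos (t-p) - gamma'(t) sin (t-p)) - |h| gamma(t)],
    and the assumption on gamma says exactly that the bracket dominates
    gamma(p). *)

(** * Plane vectors *)

Lemma dotE {R : realType} (u v : 'cV[R]_2) :
  dot u v = xc u * xc v + yc u * yc v.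
Proof.
by rewrite /dot mxE big_ord_recl big_ord1 !mxE /xc /yc; congr (_ + _ * _);
   congr (_ _ _); apply/val_inj.
Qed.

Lemma dotC {R : realType} (u v : 'cV[R]_2) : dot u v = dot v u.
Proof. by rewrite !dotE; ring. Qed.

Lemma dotZl {R : realType} (a : R) (u v : 'cV[R]_2) :
  dot (a *: u) v = a * dot u v.
Proof. by rewrite !dotE /xc /yc !mxE; ring. Qed.

Lemma dotZr {R : realType} (a : R) (u v : 'cV[R]_2) :
  dot u (a *: v) = a * dot u v.
Proof. by rewrite dotC dotZl dotC. Qed.

Lemma dotBr {R : realType} (u v w : 'cV[R]_2) :
  dot u (v - w) = dot u v - dot u w.
Proof. by rewrite !dotE /xc /yc !mxE; ring. Qed.

Lemma enorm_gt0 {R : realType} (u : 'cV[R]_2) : u != 0 -> 0 < enorm u.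
Proof.
move=> u0; rewrite /enorm sqrtr_gt0 dotE lt_def addr_ge0 ?sqr_ge0 // andbT.
apply: contraNN u0; rewrite paddr_eq0 ?sqr_ge0 // !mulf_eq0 !orbb.
move=> /andP[/eqP x0 /eqP y0]; apply/eqP/matrixP => i j; rewrite (ord1 j) mxE.
case: i => -[|[|//]] lti.
- by rewrite -[RHS]x0 /xc; congr (u _ _); apply/val_inj.
- by rewrite -[RHS]y0 /yc; congr (u _ _); apply/val_inj.
Qed.

Lemma dot_Gmx {R : realType} (gamma : R -> R) (t : R) (u v : 'cV[R]_2) :
  dot (Gmx gamma t *m u) v =
    gamma t * dot u v + dangle gamma t * (xc u * yc v - yc u * xc v).
Proof.
have l0 : lift ord0 ord0 = 1 :> 'I_2 by apply/val_inj.
by rewrite !dotE /xc /yc !mxE !big_ord_recl !big_ord0 !mxE /= !l0; ring.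
Qed.

(** * Mass lumping of piecewise constant functions *)

Lemma node_lt {R : realType} (N i j : nat) : (0 < N)%N ->
  (node R N i < node R N j) = (i < j)%N.
Proof. by move=> N0; rewrite /node ltr_pM2r ?invr_gt0 ?ltr0n // ltr_nat. Qed.

Lemma node_le {R : realType} (N i j : nat) : (0 < N)%N ->
  (node R N i <= node R N j) = (i <= j)%N.
Proof. by move=> N0; rewrite /node ler_pM2r ?invr_gt0 ?ltr0n // ler_nat. Qed.

Lemma pwconstE {R : realType} {V : nmodType} (N : nat) (c : 'I_N -> V)
    (j : 'I_N) (x : R) :
  node R N j < x < node R N j.+1 -> pwconst c x = c j.
Proof.
move=> /andP[jx xj]; have N0 : (0 < N)%N by apply: leq_ltn_trans (ltn_ord j).
rewrite /pwconst (big_pred1 j) // => i; apply/idP/eqP => [|->]; last by rewrite jx.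
move=> /andP[ix xi]; apply/val_inj/eqP; rewrite eqn_leq /=.
have := lt_trans ix xj; have := lt_trans jx xi.
by rewrite !node_lt // !ltnS => -> ->.
Qed.

(** One-sided limits at the two ends of an interval see only its interior, so
    mass lumping integrates piecewise constant functions exactly, whatever
    their values at the nodes. *)
Lemma lumped_pwconst {R : realType} (N : nat) (X : R -> 'cV[R]_2) (w : R -> R)
    (c : 'I_N -> R) :
  (forall (j : 'I_N) x, node R N j < x < node R N j.+1 -> w x = c j) ->
  lumped N X w = \sum_(j < N) enorm (edge X j) * c j.
Proof.
move=> wc; rewrite /lumped mulr_sumr; apply: eq_bigr => j _.
have N0 : (0 < N)%N by apply: leq_ltn_trans (ltn_ord j).
have jj : node R N j < node R N j.+1 by rewrite node_lt.
have -> : lim (w x @[x --> (node R N j.+1)^'-]) = c j.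
  apply/cvg_lim => //; apply: cvg_near_cst; near=> x; apply: (wc j).
  by apply/andP; split; near: x; [exact: nbhs_left_gt|exact: nbhs_left_lt].
have -> : lim (w x @[x --> (node R N j)^'+]) = c j.
  apply/cvg_lim => //; apply: cvg_near_cst; near=> x; apply: (wc j).
  by apply/andP; split; near: x; [exact: nbhs_right_gt|exact: nbhs_right_lt].
by field.
Unshelve. all: by end_near. Qed.

(** * The finite element space *)

Lemma Kph_lin {R : realType} (N : nat) (a b : R) (u v : R -> R) :
  Kph N u -> Kph N v -> Kph N (fun x => a * u x + b * v x).
Proof.
move=> [cu au pu] [cv av pv]; split; last by rewrite pu pv.
- move=> x; apply: cvgD; apply: cvgM; try exact: cvg_cst.
  + exact: cu.
  + exact: cv.
- move=> j; have [p [q uE]] := au j; have [r [s vE]] := av j.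
  exists (a * p + b * r), (a * q + b * s) => x xj.
  by rewrite (uE _ xj) (vE _ xj); ring.
Qed.

Lemma KphZ {R : realType} (N : nat) (a : R) (u : R -> R) :
  Kph N u -> Kph N (fun x => a * u x).
Proof.
move=> Ku; have := Kph_lin a 0 Ku Ku.
by congr Kph; apply/funext => x; rewrite mul0r addr0.
Qed.

Lemma XphB {R : realType} (N : nat) (X Y : R -> 'cV[R]_2) :
  Xph N X -> Xph N Y -> Xph N (fun x => X x - Y x).
Proof.
move=> [X1 X2] [Y1 Y2]; split.
- have := Kph_lin 1 (-1) X1 Y1.
  by congr Kph; apply/funext => x; rewrite /= /xc !mxE; ring.
- have := Kph_lin 1 (-1) X2 Y2.
  by congr Kph; apply/funext => x; rewrite /= /yc !mxE; ring.
Qed.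

(** * Energy estimate *)

(** The local estimate. In polar coordinates, the difference of the two sides is
    [|k| (S - gamma p) + gamma t (|k| - |h|)^2 / |h|], where S is the bound on
    gamma p in the hypothesis: the matrix G is chosen so that the
    mixed term in h and k reproduces the cosine and sine terms of S. *)
Lemma edge_energy_le {R : realType} (gamma : R -> R) (t p : R) (h k : 'cV[R]_2) :
  h != 0 -> k != 0 -> 0 < gamma t ->
  gamma p <= 2 * gamma t - gamma t * cos (t - p) - dangle gamma t * sin (t - p) ->
  cos t = xc h / enorm h -> sin t = yc h / enorm h ->
  cos p = xc k / enorm k -> sin p = yc k / enorm k ->
  enorm k * gamma p - enorm h * gamma t <=
    enorm h * dot (Gmx gamma t *m ((enorm h)^-1 *: k))
                  ((enorm h)^-1 *: (k - h)).
Proof.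
move=> /enorm_gt0 h0 /enorm_gt0 k0 g0 stab ct st cp sp.
have polar (r a x : R) : 0 < r -> a = x / r -> x = r * a.
  by move=> r0 ->; rewrite mulrC divfK ?gt_eqF.
have xh := polar _ _ _ h0 ct; have yh := polar _ _ _ h0 st.
have xk := polar _ _ _ k0 cp; have yk := polar _ _ _ k0 sp.
rewrite -scalemxAr dotZl dotZr dotBr mulrA mulfV ?gt_eqF// mul1r.
rewrite !dot_Gmx !dotE xh yh xk yk.
set a := enorm h in h0 *; set b := enorm k in k0 *.
rewrite cosB sinB in stab.
have sqp := cos2Dsin2 p.
rewrite -subr_ge0.
set S := 2 * _ - _ - _ in stab.
(* The last term vanishes; it makes the equality a field identity in which
   cos p and sin p are independent. *)
have -> : a^-1 * (gamma t * (b * cos p * (b * cos p) + b * sin p * (b * sin p)) +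
     dangle gamma t * (b * cos p * (b * sin p) - b * sin p * (b * cos p)) -
   (gamma t * (b * cos p * (a * cos t) + b * sin p * (a * sin t)) +
    dangle gamma t * (b * cos p * (a * sin t) - b * sin p * (a * cos t)))) -
  (b * gamma p - a * gamma t)
  = b * (S - gamma p) + gamma t * (b - a) ^+ 2 / a
    + gamma t * b ^+ 2 / a * (cos p ^+ 2 + sin p ^+ 2 - 1).
  by rewrite /S; field; rewrite gt_eqF.
rewrite sqp subrr mulr0 addr0 addr_ge0 //.
- by rewrite mulr_ge0 ?subr_ge0 // ltW.
- apply: divr_ge0; last exact: ltW.
  by apply: mulr_ge0; [exact: ltW | exact: sqr_ge0].
Qed.

(** Testing the scheme with [tau mu'] and [X' - X]. The factor tau makes the
    coupling terms of the two equations equal pointwise, so they cancel without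
    any knowledge of their one-sided limits. *)
Lemma scheme_dissipation {R : realType} (gamma : R -> R) (N : nat) (tau : R)
    (X : R -> 'cV[R]_2) (theta : 'I_N -> R) (X' : R -> 'cV[R]_2) (mu' : R -> R) :
  0 < tau -> Xph N X -> Xph N X' -> Kph N mu' ->
  ES_PFEM_step gamma tau X theta X' mu' ->
  \sum_(j < N) enorm (edge X j) *
    dot (Gmx gamma (theta j) *m ((enorm (edge X j))^-1 *: edge X' j))
        ((enorm (edge X j))^-1 *: (edge X' j - edge X j)) <= 0.
Proof.
move=> tau0 KX KX' Kmu [step1 step2].
have := step1 _ (KphZ tau Kmu); have := step2 _ (XphB KX' KX).
set A := ip N X mu' _; set B := ipv N X _ _.
have -> : ipv N X (fun x => tau^-1 *: (X' x - X x))
                  (fun x => (tau * mu' x) *: normal N X x) = A.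
  rewrite /A /ip /ipv; congr lumped; apply/funext => x.
  by rewrite dotZl dotZr dotC; field; rewrite gt_eqF.
have BE : B = \sum_(j < N) enorm (edge X j) *
    dot (Gmx gamma (theta j) *m ((enorm (edge X j))^-1 *: edge X' j))
        ((enorm (edge X j))^-1 *: (edge X' j - edge X j)).
  apply: lumped_pwconst => j x xj; rewrite /ds !(pwconstE _ xj) /edge.
  congr (dot _ (_ *: _)).
  by rewrite !opprB addrACA [RHS]addrACA; congr (_ + _); rewrite addrC.
set C := ip N X _ _.
have C0 : 0 <= C.
  rewrite /C /ip (@lumped_pwconst _ _ _ _ (fun j : 'I_N => tau *
     ((enorm (edge X j))^-1 * (mu' (node R N j.+1) - mu' (node R N j))) ^+ 2)).
    apply: sumr_ge0 => j _; rewrite mulr_ge0 ?sqrtr_ge0 //.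
    by rewrite mulr_ge0 ?sqr_ge0 // ltW.
  move=> j x xj; rewrite /ds !(pwconstE _ xj) /GRing.scale /=; ring.
rewrite -BE => /eqP; rewrite subr_eq0 => /eqP <- /eqP.
by rewrite addr_eq0 => /eqP ->; rewrite oppr_le0.
Qed.

Lemma energy_step {R : realType} (gamma : R -> R) (N : nat) (tau : R)
    (X : R -> 'cV[R]_2) (theta : 'I_N -> R) (X' : R -> 'cV[R]_2)
    (theta' : 'I_N -> R) (mu' : R -> R) :
  (forall t : R, - pi <= t <= pi -> 0 < gamma t) ->
  (forall t p : R, - pi <= t <= pi -> - pi <= p <= pi ->
     gamma p <= 2 * gamma t - gamma t * cos (t - p) - dangle gamma t * sin (t - p)) ->
  0 < tau -> Xph N X -> Xph N X' -> Kph N mu' ->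
  (forall j : 'I_N, edge X j != 0) -> (forall j : 'I_N, edge X' j != 0) ->
  is_angle X theta -> is_angle X' theta' ->
  ES_PFEM_step gamma tau X theta X' mu' ->
  energy gamma X' theta' <= energy gamma X theta.
Proof.
move=> g0 stab tau0 KX KX' Kmu hX hX' aX aX' step.
rewrite -subr_le0; apply: le_trans (scheme_dissipation tau0 KX KX' Kmu step).
rewrite /energy -sumrB; apply: ler_sum => j _.
have [tj ct st] := aX j; have [pj cp sp] := aX' j.
by apply: edge_energy_le => //; [exact: g0 | exact: stab].
Qed.

Theorem theorem4p2 (R : realType) (gamma : R -> R)
  (gamma_C1 : C1_within `[- pi, pi] gamma)
  (gamma_gt0 : forall theta : R, - pi <= theta <= pi -> 0 < gamma theta)
  (gamma_per : gamma (- pi) = gamma pi)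
  (gamma_stable : forall theta phi : R,
     - pi <= theta <= pi -> - pi <= phi <= pi ->
     gamma phi <= 2 * gamma theta - gamma theta * cos (theta - phi)
                  - dangle gamma theta * sin (theta - phi))
  (N : nat) (N_ge3 : (3 <= N)%N) (tau : R) (tau_gt0 : 0 < tau)
  (X : nat -> R -> 'cV[R]_2) (mu : nat -> R -> R) (theta : nat -> 'I_N -> R)
  (X_Xph : forall m, Xph N (X m))
  (mu_Kph : forall m, Kph N (mu m.+1))
  (edge_neq0 : forall m (j : 'I_N), edge (X m) j != 0)
  (theta_angle : forall m, is_angle (X m) (theta m))
  (scheme : forall m,
     ES_PFEM_step gamma tau (X m) (theta m) (X m.+1) (mu m.+1)) :
  forall m : nat,
    energy gamma (X m.+1) (theta m.+1) <= energy gamma (X m) (theta m)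
      <= energy gamma (X 0%N) (theta 0%N).
Proof.
have decr m : energy gamma (X m.+1) (theta m.+1) <= energy gamma (X m) (theta m).
  by apply: energy_step (scheme m).
move=> m; rewrite decr /=; elim: m => [//|m IHm]; exact: le_trans (decr m) IHm.
Qed.
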